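(* The collection of metric families with regular finite decomposition complexity is the smallest collection of metric families that contains all families with finite asymptotic dimension and satisfies Fibering Permanence.
   Context: A metric family is a set of metric spaces. A map of metric families $F\colon\mathcal{X}\to\mathcal{Y}$ is a collection of functions $f\colon X\to Y$ with $X\in\mathcal{X}$, $Y\in\mathcal{Y}$, such that each element of $\mathcal{X}$ is the domain of at least one function in $F$. $F$ is coarse if there is a non-decreasing function $\rho\colon[0,\infty)\to[0,\infty)$ with $d_Y(f(x),f(y))\le\rho(d_X(x,y))$ for all $f\colon X\to Y$ in $F$ and $x,y\in X$. A subfamily of $\mathcal{Y}$ is a metric family each of whose members is a subspace of some $Y\in\mathcal{Y}$; the inverse image of a subfamily $\mathcal{B}$ is $F^{-1}(\mathcal{B})=\{f^{-1}(B)\mid B\in\mathcal{B},\ f\in F\}$ (where $B$ is a subspace of the codomain of $f$). $\mathcal{X}$ is bounded if $\sup_{X\in\mathcal{X}}\operatorname{diam}X<\infty$. $\operatorname{asdim}(\mathcal{X})\le n$ means: for every $r>0$, each $X\in\mathcal{X}$ has a decomposition $X=X_0\cup\dots\cup X_n$ where each $X_i$ is a union of subspaces $X_{ij}$, $j\in J_i$, with $d(x,y)>r$ whenever $x\in X_{ij}$, $y\in X_{ij'}$, $j\ne j'$, such that the family of all $X_{ij}$ (over all $X$, $i$, $j$) is bounded. $\mathcal{X}$ has finite asymptotic dimension if $\operatorname{asdim}(\mathcal{X})\le n$ for some $n$. Let $\mathfrak{R}_0$ be the collection of bounded metric families. For an ordinal $\alpha>0$, $\mathcal{X}\in\mathfrak{R}_\alpha$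 if there are a metric family $\mathcal{Y}$ with finite asymptotic dimension and a coarse map $F\colon\mathcal{X}\to\mathcal{Y}$ such that for every bounded subfamily $\mathcal{B}$ of $\mathcal{Y}$ there is an ordinal $\beta<\alpha$ with $F^{-1}(\mathcal{B})\in\mathfrak{R}_\beta$. A metric family has regular finite decomposition complexity (regular FDC) if it lies in $\mathfrak{R}_\alpha$ for some countable ordinal $\alpha$. A collection $\mathfrak{C}$ of metric families satisfies Fibering Permanence if: whenever $F\colon\mathcal{X}\to\mathcal{Y}$ is a coarse map, $\mathcal{Y}\in\mathfrak{C}$, and $F^{-1}(\mathcal{Z})\in\mathfrak{C}$ for every bounded subfamily $\mathcal{Z}$ of $\mathcal{Y}$, then $\mathcal{X}\in\mathfrak{C}$. *)

(* Defs.v *)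
From HB Require Import structures.
From mathcomp Require Import all_boot all_order all_algebra.
From mathcomp Require Import all_classical all_reals all_analysis.
From mathcomp Require wochoice.

Set Implicit Arguments.
Unset Strict Implicit.
Unset Printing Implicit Defensive.

Import Order.TTheory GRing.Theory Num.Theory.
Local Open Scope classical_set_scope.
Local Open Scope ring_scope.

(* [set_type A] already carries the initial topology; the alias lets the
   restricted distance generate the structure instead. *)
Definition metric_subspace (R : realType) (T : metricType R) (A : set T) : Type :=
  set_type A.

Section MetricSubspace.
Variables (R : realType) (T : metricType R) (A : set T).
Implicit Types x y z : metric_subspace A.

HB.instance Definition _ := Choice.copy (metric_subspace A) (set_type A).

Let dist x y : R := mdist (\val x) (\val y).

Let distxx x : dist x x = 0.
Proof. exact: mdistxx. Qed.

Let dist_positivity x y : dist x y = 0 -> x = y.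
Proof. by move=> /mdist_positivity /val_inj. Qed.

Let dist_sym x y : dist x y = dist y x.
Proof. exact: metric_sym. Qed.

Let dist_triangle y x z : dist x z <= dist x y + dist y z.
Proof. exact: metric_triangle. Qed.

HB.instance Definition _ := @isMetric.Build R (metric_subspace A)
  dist distxx dist_positivity dist_sym dist_triangle.

End MetricSubspace.

(* A set of metric spaces is given by an indexing of its members; repetitions
   are allowed. *)
Record metric_family (R : realType) := MetricFamily {
  mf_index :> Type;
  mf_space :> mf_index -> metricType R }.

Section MetricFamilies.
Variable R : realType.
Implicit Types X Y : metric_family R.

(* The diameter of the empty space is -oo here, which is harmless since
   diameters are only ever bounded from above. *)
Definition diam (T : metricType R) : \bar R :=
  ereal_sup [set (mdist xy.1 xy.2)%:E | xy in [set: T * T]].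

Definition bounded_family X : Prop :=
  (ereal_sup [set diam (X i) | i in [set: X]] < +oo)%E.

Definition subfamily Y := forall j : Y, set (set (Y j)).

Definition family_of_subfamily Y (B : subfamily Y) : metric_family R :=
  @MetricFamily R {j : Y & {A : set (Y j) | B j A}}
    (fun p => metric_subspace (sval (projT2 p))).

Record family_map X Y := FamilyMap {
  fm_fun :> forall (i : X) (j : Y), set (X i -> Y j);
  fm_total : forall i : X, exists j f, @fm_fun i j f }.

Definition coarse X Y (F : family_map X Y) : Prop :=
  exists rho : R -> R,
    [/\ forall t, 0 <= t -> 0 <= rho t,
        {in Num.nneg &, {homo rho : s t / s <= t}}
      & forall i j f, F i j f ->
          forall x y : X i, mdist (f x) (f y) <= rho (mdist x y)].

Definition inverse_image X Y (F : family_map X Y) (B : subfamily Y) :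
    subfamily X :=
  fun i => [set A | exists j f S, [/\ F i j f, B j S & A = f @^-1` S]].

Definition asdim_le X (n : nat) : Prop :=
  forall r : R, 0 < r ->
  exists (J : forall i : X, 'I_n.+1 -> Type)
         (piece : forall (i : X) (k : 'I_n.+1), J i k -> set (X i)),
    [/\ forall i : X, [set: X i] =
          \bigcup_(k in [set: 'I_n.+1]) \bigcup_(j in [set: J i k]) piece i k j,
        forall (i : X) (k : 'I_n.+1) (j j' : J i k), j <> j' ->
          forall x y, piece i k j x -> piece i k j' y -> r < mdist x y
      & bounded_family (@family_of_subfamily X
          (fun i => [set A | exists k j, A = piece i k j]))].

Definition finite_asdim X : Prop := exists n, asdim_le X n.

End MetricFamilies.

(* An ordinal is represented by any well-ordered type having it as order
   type. *)
Record well_ordered := WellOrdered {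
  wo_car :> Type;
  wo_le : rel wo_car;
  wo_leP : wochoice.well_order wo_le }.

(* beta < alpha iff beta is isomorphic to the proper initial segment of alpha
   below some element a. *)
Definition ord_lt (beta alpha : well_ordered) : Prop :=
  exists (f : beta -> alpha) (a : alpha),
    (forall x y, wo_le (f x) (f y) = wo_le x y) /\
    range f = [set z | wo_le z a /\ z <> a].

Section RegularFDC.
Variable R : realType.

(* [regular_rank alpha X] is the membership of X in the alpha-th collection of
   the hierarchy. Since ord_lt is well founded, the inductive definition is the
   recursion on ordinals. The ordinal zero is represented by the empty
   well-ordered types, the positive ones by the inhabited ones. *)
Inductive regular_rank (alpha : well_ordered) (X : metric_family R) : Prop :=
| regular_rank_zero of ~ inhabited alpha & bounded_family X
| regular_rank_pos (Y : metric_family R) (F : family_map X Y) of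
    inhabited alpha & finite_asdim Y & coarse F &
    (forall B : subfamily Y, bounded_family (family_of_subfamily B) ->
       exists2 beta, ord_lt beta alpha &
         regular_rank beta (family_of_subfamily (inverse_image F B))).

Definition regular_FDC (X : metric_family R) : Prop :=
  exists2 alpha : well_ordered,
    countable [set: alpha] & regular_rank alpha X.

(* Collections are not of type [set (metric_family R)]: the library's [set] is
   not universe polymorphic, and sets of points already occur in the index
   types of families. *)
Definition fibering_permanence (C : metric_family R -> Prop) : Prop :=
  forall (X Y : metric_family R) (F : family_map X Y), coarse F -> C Y ->
    (forall Z : subfamily Y, bounded_family (family_of_subfamily Z) ->
       C (family_of_subfamily (inverse_image F Z))) ->
    C X.

End RegularFDC.

(* Main.v *)
Require Import Defs.
From mathcomp Require Import all_boot all_order all_algebra.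
From mathcomp Require Import all_classical all_reals all_analysis.
From mathcomp Require wochoice.

(** Minimality is an induction on the rank. A bounded family has finite
    asymptotic dimension, and a family of positive rank maps to a family of
    finite asymptotic dimension with inverse images of smaller rank, so that a
    collection with the two properties contains it by fibering permanence.

    For the other two claims the key is [regular_FDC_over_finite_asdim]: if [X]
    has a coarse map to a family [Y] of finite asymptotic dimension and the
    inverse images of the bounded subfamilies of [Y] all have regular FDC, then
    so has [X]. What has to be proved is that the ranks of these inverse images
    have a common countable bound. Each bounded subfamily of [Y] lies in the
    subfamily of all subsets of diameter at most [n], for some natural number
    [n], so it suffices to bound the ranks for this sequence of subfamilies; a
    countable sum of countable ordinals does it. The reduction rests on
    [regular_rank_mono]: ranks can be increased, and families replaced by
    families of subspaces.

    With the identity map, the key lemma shows that families of finite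
    asymptotic dimension have regular FDC. Fibering permanence for a map from
    [X] to [Y] follows by induction on the rank of [Y], again by the key lemma,
    applied to the composite of this map with the one that exhibits the rank of
    [Y]. *)

Set Implicit Arguments.
Unset Strict Implicit.
Unset Printing Implicit Defensive.

Import Order.TTheory GRing.Theory Num.Theory.
Local Open Scope classical_set_scope.
Local Open Scope ring_scope.

(** * Well-orders *)

Section WellOrders.
Import wochoice.

Section WellOrderTheory.
Variables (T : Type) (R : rel T).
Hypothesis R_wo : well_order R.

Lemma well_order_min (A : set T) a : A a ->
  exists! z, A z /\ forall y, A y -> R z y.
Proof.
move=> Aa.
have A_ne : nonempty (fun x => `[< A x >]) by exists a; apply/asboolP.
have [z [[/asboolP zA zmin] zuniq]] := R_wo A_ne.
exists z; split.
  by split=> // y Ay; apply: zmin; exact/asboolP.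
move=> y [Ay ymin]; apply: zuniq; split; first exact/asboolP.
by move=> w /asboolP; exact: ymin.
Qed.

Lemma well_order_refl x : R x x.
Proof. by have [_ [[<- zmin] _]] := well_order_min (erefl x); exact: zmin. Qed.

Lemma well_order_anti x y : R x y -> R y x -> x = y.
Proof.
move=> xy yx.
have xA : [set z | z = x \/ z = y] x by left.
have [z [_ zuniq]] := well_order_min xA.
rewrite -(zuniq x); last by split=> // w [] ->; rewrite ?well_order_refl.
by apply: zuniq; split; [right|move=> w [] ->; rewrite ?well_order_refl].
Qed.

End WellOrderTheory.

Lemma well_order_of_min (T : Type) (R : rel T) : antisymmetric R ->
  (forall (A : set T) a, A a -> exists2 z, A z & forall y, A y -> R z y) ->
  well_order R.
Proof.
move=> R_anti R_min; apply: antisymmetric_well_order => // A [a Aa].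
by have [z Az zmin] := R_min [set x | x \in A] a Aa; exists z.
Qed.

Lemma well_order_pullback (T S : Type) (R : rel T) (Q : rel S) (e : S -> T) :
  well_order R -> injective e -> (forall x y, R (e x) (e y) = Q x y) ->
  well_order Q.
Proof.
move=> R_wo e_inj eR; apply: well_order_of_min => [x y|A a Aa].
  by rewrite -!eR => /andP[xy yx]; apply: e_inj; exact: well_order_anti xy yx.
have [_ [[[s As <-] smin] _]] := well_order_min R_wo (imageP e Aa).
by exists s => // t At; rewrite -eR; apply: smin; exists t.
Qed.

(** An arbitrary order embedding, not one onto an initial segment: it suffices
    to compare ranks, and the summands of an ordinal sum embed in this sense at
    once, with no comparison theorem for ordinals. *)
Definition wo_embeds (alpha beta : well_ordered) : Prop :=
  exists2 e : alpha -> beta,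
    injective e & forall x y, wo_le (e x) (e y) = wo_le x y.

Section Segment.
Variables (alpha : well_ordered) (a : alpha).

Definition segment_car := {z : alpha | wo_le z a /\ z <> a}.

Definition segment_le : rel segment_car := fun x y => wo_le (sval x) (sval y).

Lemma segment_wo : well_order segment_le.
Proof.
apply: (well_order_pullback (@wo_leP alpha) (e := sval)) => // -[x p] [y q] /=.
exact: eq_exist.
Qed.

Definition segment := WellOrdered segment_wo.

Lemma segment_lt : ord_lt segment alpha.
Proof.
exists (fun z : segment => sval z), a; split=> //.
by apply/seteqP; split=> [_ [[z za] _ <-]//|z za]; exists (exist _ z za).
Qed.

End Segment.

Lemma empty_ord_lt (alpha : well_ordered) :
  inhabited alpha -> exists2 beta, ord_lt beta alpha & ~ inhabited beta.
Proof.
move=> [a].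
have [m [[_ mmin] _]] := well_order_min (@wo_leP alpha) (I : setT a).
exists (segment m); first exact: segment_lt.
move=> [[z [zm]]]; apply.
by apply: (well_order_anti (@wo_leP alpha)) => //; exact: mmin.
Qed.

(** An order embedding [e] restricts to the elements below [a], all of which it
    sends below [e a]. *)
Lemma wo_embeds_lt (beta alpha delta : well_ordered) :
  ord_lt beta alpha -> wo_embeds alpha delta ->
  exists2 gamma, ord_lt gamma delta & wo_embeds beta gamma.
Proof.
move=> [f [a [f_le f_range]]] [e e_inj e_le].
have f_below x : wo_le (f x) a /\ f x <> a.
  by have : range f (f x) by []; rewrite f_range.
exists (segment (e a)); first exact: segment_lt.
have e_below x : wo_le (e (f x)) (e a) /\ e (f x) <> e a.
  by have [le ne] := f_below x; split; [rewrite e_le|move/e_inj].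
exists (fun x => exist _ (e (f x)) (e_below x) : segment (e a)).
  move=> x y /(congr1 sval)/= /e_inj fxy.
  by apply: (well_order_anti (@wo_leP beta)); rewrite -f_le fxy;
    exact: well_order_refl (@wo_leP alpha) _.
by move=> x y; rewrite -f_le -e_le.
Qed.

Lemma void_wo : well_order (fun _ _ : void => true).
Proof. by apply: well_order_of_min => [[]|A []]. Qed.

Definition wo_empty := WellOrdered void_wo.

Section Succ.
Variable alpha : well_ordered.

Definition succ_le : rel (option alpha) := fun x y =>
  match x, y with
  | _, None => true
  | None, Some _ => false
  | Some x', Some y' => wo_le x' y'
  end.

Lemma succ_wo : well_order succ_le.
Proof.
apply: well_order_of_min => [[x|] [y|] //= /andP[xy yx]|A a Aa].
  by congr Some; exact: (well_order_anti (@wo_leP alpha)).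
have [[x Ax]|noA] := pselect (exists x, A (Some x)); last first.
  exists None => [|[y|] // Ay]; last by case: noA; exists y.
  by case: a Aa => // y Ay; case: noA; exists y.
have [z [[zA zmin] _]] := well_order_min (@wo_leP alpha) (Ax : (A \o Some) x).
by exists (Some z) => // -[y|] // Ay; exact: zmin.
Qed.

Definition wo_succ := WellOrdered succ_wo.

Lemma wo_succ_lt : ord_lt alpha wo_succ.
Proof.
exists (fun x => Some x : wo_succ), None; split=> //.
apply/seteqP; split=> [_ [x _ <-]//|[x|] [] //= _ _]; by exists x.
Qed.

Lemma wo_succ_countable :
  countable [set: alpha] -> countable [set: wo_succ].
Proof.
move=> /countable_injP[f f_inj].
apply/countable_injP; exists (fun x => if x is Some y then (f y).+1 else 0%N).
move=> [x|] [y|] _ _ // [] /f_inj -> //; exact: in_setT.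
Qed.

End Succ.

Section Sum.
Variable alpha : nat -> well_ordered.

Definition sum_car := {n : nat & alpha n}.

Definition sum_le : rel sum_car := fun p q =>
  (tag p < tag q)%N
  || (tag p == tag q) && wo_le (tagged p) (tagged_as p q).

Lemma sum_le_fiber n (x y : alpha n) :
  sum_le (Tagged alpha x) (Tagged alpha y) = wo_le x y.
Proof. by rewrite /sum_le /= ltnn eqxx tagged_asE. Qed.

Lemma sum_wo : well_order sum_le.
Proof.
apply: well_order_of_min => [[n x] [m y] /andP[]|A [k a] Aa].
  have [nm|nm|nm] := ltngtP n m.
  - by move=> _; rewrite /sum_le /= ltnNge (ltnW nm) (gtn_eqF nm).
  - by rewrite {1}/sum_le /= ltnNge (ltnW nm) (gtn_eqF nm).
  case: _ / nm y => y; rewrite !sum_le_fiber => xy yx; congr existT.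
  exact: (well_order_anti (@wo_leP (alpha n))).
have : exists n, `[< exists x : alpha n, A (existT _ n x) >].
  by exists k; apply/asboolP; exists a.
case/ex_minnP => n /asboolP[x Ax] nmin.
have [z [[zA zmin] _]] := well_order_min (@wo_leP (alpha n))
  (Ax : [set x | A (existT _ n x)] x).
exists (existT _ n z) => // -[m y] Ay.
have : (n <= m)%N by apply: nmin; apply/asboolP; exists y.
rewrite leq_eqVlt => /predU1P[nm|nm]; last by rewrite /sum_le /= nm.
by case: _ / nm y Ay => y Ay; rewrite sum_le_fiber; apply: zmin.
Qed.

Definition wo_sum := WellOrdered sum_wo.

Lemma wo_sum_embeds n : wo_embeds (alpha n) wo_sum.
Proof.
exists (fun x => Tagged alpha x : wo_sum); last exact: sum_le_fiber.
move=> x y /(congr1 (tagged_as (Tagged alpha x))).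
by rewrite !tagged_asE.
Qed.

Lemma wo_sum_countable :
  (forall n, countable [set: alpha n]) -> countable [set: wo_sum].
Proof.
move=> alpha_ct.
have -> : [set: wo_sum] = \bigcup_(n in setT) (Tagged alpha @` [set: alpha n]).
  by apply/seteqP; split=> // -[n x] _; exists n => //; exists x.
apply: bigcup_countable => [|n _]; first exact: countableP.
exact: sub_countable (card_image_le _ _) (alpha_ct n).
Qed.

End Sum.

End WellOrders.

(** * Metric families, composite maps and isometric embeddings *)

Section Families.
Variable R : realType.
Implicit Types (X Y Z W : metric_family R) (alpha beta delta : well_ordered).

Lemma bounded_familyP X :
  bounded_family X <->
  exists M : R, forall (i : X) (x y : X i), mdist x y <= M.
Proof.
split=> [|[M XM]]; last first.
  apply: (@le_lt_trans _ _ M%:E); last exact: ltry.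
  apply: ub_ereal_sup => _ [i _ <-]; apply: ub_ereal_sup => _ [xy _ <-].
  by rewrite lee_fin.
rewrite /bounded_family; set s := ereal_sup _ => s_fin.
(* The supremum over an empty family is -oo, hence the maximum with 0. *)
exists (fine (maxe s 0%E)) => i x y.
rewrite -lee_fin fineK; last first.
  rewrite ge0_fin_numE; last by rewrite le_max lexx orbT.
  by rewrite gt_max s_fin ltry.
rewrite le_max; apply/orP; left.
apply: (@le_trans _ _ (diam (X i))).
  by apply: ereal_sup_ubound; exists (x, y).
by apply: ereal_sup_ubound; exists i.
Qed.

Lemma bounded_subfamilyP Y (B : subfamily Y) :
  bounded_family (family_of_subfamily B) <->
  exists M : R, forall j S, B j S -> forall x y, S x -> S y -> mdist x y <= M.
Proof.
rewrite bounded_familyP; split=> -[M BM]; exists M.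
  move=> j S BS x y Sx Sy.
  exact: (BM (existT _ j (exist _ S BS))
    (exist _ x (mem_set Sx)) (exist _ y (mem_set Sy))).
move=> [j [S BS]] x y.
exact: (BM j S BS _ _ (set_mem (svalP x)) (set_mem (svalP y))).
Qed.

(** At every scale, take each space as its own single piece. *)
Lemma bounded_finite_asdim X : bounded_family X -> finite_asdim X.
Proof.
move=> /bounded_familyP[M XM]; exists 0%N => r _.
exists (fun _ _ => unit), (fun _ _ _ => setT); split.
- by move=> i; apply/seteqP; split=> // x _; exists ord0 => //; exists tt.
- by move=> i k [] [] /(_ erefl).
- by apply/bounded_subfamilyP; exists M => i *; exact: XM.
Qed.

Definition subspace_map (T U : metricType R) (A : set T) (B : set U)
    (f : T -> U) (fAB : forall x, A x -> B (f x)) :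
    metric_subspace A -> metric_subspace B :=
  fun x => exist _ (f (sval x)) (mem_set (fAB _ (set_mem (svalP x)))).

Section Composition.
Variables (X Y Z : metric_family R).
Variables (F : family_map X Y) (G : family_map Y Z).

Definition comp_fun (i : X) (k : Z) : set (X i -> Z k) :=
  [set h | exists j f g, [/\ F i j f, G j k g & h = g \o f]].

Lemma comp_total i : exists k h, comp_fun (i := i) (k := k) h.
Proof.
have [j [f Ff]] := fm_total F i; have [k [g Gg]] := fm_total G j.
by exists k, (g \o f), j, f, g.
Qed.

Definition comp_map : family_map X Z := FamilyMap comp_total.

Lemma coarse_comp : coarse F -> coarse G -> coarse comp_map.
Proof.
move=> [r [r0 rmono Fr]] [s [s0 smono Gs]]; exists (s \o r); split.
- by move=> t t0; apply: s0; exact: r0.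
- move=> t u; rewrite !nnegrE => t0 u0 tu /=.
  by apply: smono; rewrite ?nnegrE ?r0//; apply: rmono; rewrite ?nnegrE.
- move=> i k _ [j [f [g [Ff Gg ->]]]] x y /=.
  apply: (le_trans (Gs _ _ _ Gg _ _)); apply: smono.
  + by rewrite nnegrE mdist_ge0.
  + by rewrite nnegrE r0// mdist_ge0.
  + exact: Fr.
Qed.

End Composition.

(** Spaces obtained by taking a subspace of a subspace, or the same subspace
    through two different maps, are isometric without being equal; this
    relation absorbs the difference, as well as the passage to subfamilies. *)
Definition isometrically_embeds X X' : Prop :=
  forall i : X, exists (i' : X') (e : X i -> X' i'),
    forall x y, mdist (e x) (e y) = mdist x y.

Lemma isometrically_embeds_refl X : isometrically_embeds X X.
Proof. by move=> i; exists i, id. Qed.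

Section IsometricEmbedding.
Variables (X X' : metric_family R).
Hypothesis XX' : isometrically_embeds X X'.

Definition isometry_map : family_map X X' :=
  @FamilyMap R X X'
    (fun i i' => [set e | forall x y, mdist (e x) (e y) = mdist x y]) XX'.

Lemma isometry_coarse : coarse isometry_map.
Proof. by exists id; split=> // i j e eE x y; rewrite eE. Qed.

Lemma isometry_bounded : bounded_family X' -> bounded_family X.
Proof.
move=> /bounded_familyP[M X'M]; apply/bounded_familyP; exists M => i x y.
by have [i' [e <-]] := XX' i; exact: X'M.
Qed.

Lemma isometry_inverse_image_bounded (B : subfamily X') :
  bounded_family (family_of_subfamily B) ->
  bounded_family (family_of_subfamily (inverse_image isometry_map B)).
Proof.
move=> /bounded_subfamilyP[M BM]; apply/bounded_subfamilyP; exists M.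
move=> i _ [i' [e [S [eE BS ->]]]] x y Sx Sy.
by rewrite -eE; exact: (BM _ _ BS).
Qed.

(** For [e] in the isometry and [f] in [F], [e] embeds the inverse image of [S]
    under the composite into the inverse image of [S] under [f]. This makes
    isometric embeddings compatible with the recursion defining the ranks. *)
Lemma inverse_image_comp_isometry Y (F : family_map X' Y) (B : subfamily Y) :
  isometrically_embeds
    (family_of_subfamily (inverse_image (comp_map isometry_map F) B))
    (family_of_subfamily (inverse_image F B)).
Proof.
move=> [i [A /= [k [_ [S [[i' [e [f [eE Ff ->]]] BS AE]]]]]]].
have FS : inverse_image F B (f @^-1` S) by exists k, f, S.
have eA x : A x -> (f @^-1` S) (e x) by rewrite AE.
exists (existT _ i' (exist _ _ FS)), (subspace_map eA) => x y.
exact: eE.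
Qed.

End IsometricEmbedding.

(** * The hierarchy of ranks *)

(** The recursive occurrence in [regular_rank] sits under an existential, where
    the generated principle gives no induction hypothesis. *)
Lemma regular_rank_induction (P : well_ordered -> metric_family R -> Prop) :
  (forall alpha X, ~ inhabited alpha -> bounded_family X -> P alpha X) ->
  (forall alpha X Y (F : family_map X Y),
    inhabited alpha -> finite_asdim Y -> coarse F ->
    (forall B : subfamily Y, bounded_family (family_of_subfamily B) ->
      exists2 beta, ord_lt beta alpha &
        P beta (family_of_subfamily (inverse_image F B))) ->
    P alpha X) ->
  forall alpha X, regular_rank alpha X -> P alpha X.
Proof.
move=> P0 Ppos; fix IH 3 => alpha X [alpha0 bX|Y F alpha0 fY cF FB].
  exact: P0.
apply: (Ppos _ _ Y F) => // B /FB[beta lt_beta rk_beta].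
by exists beta => //; exact: IH.
Qed.

(** In positive rank, use the identity map of [X]: all inverse images are
    bounded, hence of rank zero. *)
Lemma regular_rank_bounded (alpha : well_ordered) X :
  bounded_family X -> regular_rank alpha X.
Proof.
move=> bX; have [alpha1|alpha0] := pselect (inhabited alpha); last first.
  exact: regular_rank_zero.
have XX : isometrically_embeds X X := isometrically_embeds_refl (X := X).
apply: (regular_rank_pos (F := isometry_map XX)) => //.
- exact: bounded_finite_asdim.
- exact: isometry_coarse.
move=> B bB; have [beta lt_beta beta0] := empty_ord_lt alpha1.
exists beta => //; apply: regular_rank_zero => //.
exact: isometry_inverse_image_bounded.
Qed.

(** In positive rank, compose the map from [X'] that exhibits its rank with the
    embedding of [X] into [X']; the ranks below [alpha] are sent to ranks below
    [delta] by [wo_embeds_lt]. In rank zero, [delta] may still be positive. *)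
Lemma regular_rank_mono (alpha delta : well_ordered) X X' :
  wo_embeds alpha delta -> isometrically_embeds X X' ->
  regular_rank alpha X' -> regular_rank delta X.
Proof.
move=> + + rk; move: delta X.
elim/regular_rank_induction: alpha X' / rk.
  move=> alpha X' _ bX' delta X _ XX'.
  exact: regular_rank_bounded (isometry_bounded XX' bX').
move=> alpha X' Y F [a] fY cF IH delta X ad XX'.
apply: (regular_rank_pos (F := comp_map (isometry_map XX') F)) => //.
- by case: ad => e _ _; exists; exact: e a.
- by apply: coarse_comp => //; exact: isometry_coarse.
move=> B /IH[beta lt_beta IHbeta].
have [gamma lt_gamma bg] := wo_embeds_lt lt_beta ad.
by exists gamma => //; apply: IHbeta => //; exact: inverse_image_comp_isometry.
Qed.

Lemma regular_FDC_embeds X X' :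
  isometrically_embeds X X' -> regular_FDC X' -> regular_FDC X.
Proof.
move=> XX' [alpha ca rk]; exists alpha => //.
by apply: regular_rank_mono XX' rk; exists id.
Qed.

Lemma regular_FDC_bounded X : bounded_family X -> regular_FDC X.
Proof.
move=> bX; exists wo_empty; last exact: regular_rank_bounded.
exact: (@countableP void).
Qed.

(** These subfamilies form a countable cofinal system: every bounded subfamily
    lies in one of them. *)
Definition diam_le_subfamily Y (n : nat) : subfamily Y :=
  fun j => [set S | forall x y, S x -> S y -> mdist x y <= n%:R].

(** The hypothesis provides a countable rank for each of the possibly
    uncountably many bounded subfamilies, with no common bound. Monotonicity
    reduces them to the sequence [diam_le_subfamily], whose ranks are all
    dominated by their sum; the successor of the sum is a countable rank for
    [X]. *)
Lemma regular_FDC_over_finite_asdim X Y (F : family_map X Y) :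
  coarse F -> finite_asdim Y ->
  (forall B : subfamily Y, bounded_family (family_of_subfamily B) ->
    regular_FDC (family_of_subfamily (inverse_image F B))) ->
  regular_FDC X.
Proof.
move=> cF fY FB.
have /choice[alpha alphaP] n : exists alpha : well_ordered,
    countable [set: alpha] /\
    regular_rank alpha
      (family_of_subfamily (inverse_image F (diam_le_subfamily (Y := Y) n))).
  have [|alpha ca rk] := FB (diam_le_subfamily (Y := Y) n).
    by apply/bounded_subfamilyP; exists n%:R.
  by exists alpha.
exists (wo_succ (wo_sum alpha)).
  by apply/wo_succ_countable/wo_sum_countable => n; have [] := alphaP n.
apply: (regular_rank_pos (F := F)) => //; first by exists; exact: None.
move=> B /bounded_subfamilyP[M BM].
exists (wo_sum alpha); first exact: wo_succ_lt.
have [n Mn] : exists n : nat, M <= n%:R.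
  exists (Num.truncn `|M|).+1.
  by rewrite (le_trans (ler_norm M))// ltW// truncnS_gt.
have [_ rk] := alphaP n.
apply: regular_rank_mono (wo_sum_embeds alpha n) _ rk.
move=> [i [A /= [j [f [S [Ff BS AE]]]]]].
have FA : inverse_image F (diam_le_subfamily (Y := Y) n) A.
  exists j, f, S; split=> // x y Sx Sy.
  exact: le_trans (BM _ _ BS _ _ Sx Sy) Mn.
by exists (existT _ i (exist _ A FA)), id.
Qed.

Lemma finite_asdim_regular_FDC X : finite_asdim X -> regular_FDC X.
Proof.
move=> fX.
have XX : isometrically_embeds X X := isometrically_embeds_refl (X := X).
apply: (regular_FDC_over_finite_asdim (F := isometry_map XX)) => //.
  exact: isometry_coarse.
move=> B bB; apply: regular_FDC_bounded.
exact: isometry_inverse_image_bounded.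
Qed.

(** * Restricting a map of families over the inverse image of a subfamily *)

Section Restriction.
Variables (X Y W : metric_family R) (F : family_map X Y) (G : family_map Y W).
Variable B : subfamily W.

Let XB := family_of_subfamily (inverse_image (comp_map F G) B).
Let YB := family_of_subfamily (inverse_image G B).

(** All maps that [F] induces between members of the two families are included,
    also those for which the sources and targets do not come from the same
    member of [B]; each of them is controlled by the same function as [F]. *)
Definition restr_fun (p : XB) (q : YB) : set (XB p -> YB q) :=
  [set phi | exists2 f : X (tag p) -> Y (tag q), F (tag p) (tag q) f &
    forall x, sval (phi x) = f (sval x)].

Lemma restr_total p : exists q phi, restr_fun (p := p) (q := q) phi.
Proof.
case: p => i [A iA].
have [k [_ [S [[j [f [g [Ff Gg ->]]]] BS AE]]]] := iA.
have GS : inverse_image G B (g @^-1` S) by exists k, g, S.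
have fA x : A x -> (g @^-1` S) (f x) by rewrite AE.
by exists (existT _ j (exist _ _ GS)), (subspace_map fA), f.
Qed.

Definition restr_map : family_map XB YB := FamilyMap restr_total.

Lemma restr_coarse : coarse F -> coarse restr_map.
Proof.
move=> [r [r0 rmono Fr]]; exists r; split=> // p q phi [f Ff phiE] x y.
have -> : mdist (phi x) (phi y) = mdist (f (sval x)) (f (sval y)).
  by rewrite -!phiE.
exact: Fr.
Qed.

(** The members of [D] are subsets of subspaces of the spaces of [Y]. Seen in
    [Y], they have inverse images under [F] itself, to which the hypothesis of
    fibering permanence applies. *)
Definition push_subfamily (D : subfamily YB) : subfamily Y :=
  fun j => [set S : set (Y j) | exists q (T : set (YB (existT _ j q))),
    D _ T /\ S = (fun y => sval y) @` T].

Lemma push_subfamily_bounded (D : subfamily YB) :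
  bounded_family (family_of_subfamily D) ->
  bounded_family (family_of_subfamily (push_subfamily D)).
Proof.
move=> /bounded_subfamilyP[M DM]; apply/bounded_subfamilyP; exists M.
move=> j _ [q [T [DT ->]]] _ _ [x Tx <-] [y Ty <-].
exact: (DM _ _ DT _ _ Tx Ty).
Qed.

(** A point of a member on the left is a point of a subspace of a subspace of
    some space of [X]; the embedding views it in that space. *)
Lemma restr_inverse_image (D : subfamily YB) :
  isometrically_embeds
    (family_of_subfamily (inverse_image restr_map D))
    (family_of_subfamily (inverse_image F (push_subfamily D))).
Proof.
move=> [p [A /= [[j q] [phi [T [[f Ff phiE] DT AE]]]]]].
pose S : set (Y j) := (fun y => sval y) @` T.
have FS : inverse_image F (push_subfamily D) (f @^-1` S).
  by exists j, f, S; split=> //; exists q, T.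
have AS (x : XB p) : A x -> (f @^-1` S) (sval x).
  by rewrite AE => Tx; exists (phi x) => //; exact: phiE.
by exists (existT _ (tag p) (exist _ _ FS)), (subspace_map AS).
Qed.

End Restriction.

(** * Fibering permanence and minimality *)

(** Induction on the rank of [Y], through a map [G] from [Y] to a family [W] of
    finite asymptotic dimension: [X] maps to [W] by the composite of [F] and
    [G], and the inverse image of a bounded [B] maps by the restriction of [F]
    to the inverse image of [B] under [G], a family of smaller rank to which
    the induction hypothesis applies. *)
Lemma regular_FDC_fibering : fibering_permanence (@regular_FDC R).
Proof.
move=> X Y F cF [alpha _ rk]; move: X F cF.
elim/regular_rank_induction: alpha Y / rk.
  (* A bounded [Y] has finite asymptotic dimension itself. *)
  move=> _ Y _ bY X F cF FB.
  exact: regular_FDC_over_finite_asdim cF (bounded_finite_asdim bY) FB.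
move=> alpha Y W G _ fW cG IH X F cF FB.
apply: (regular_FDC_over_finite_asdim (F := comp_map F G)) => //.
  exact: coarse_comp.
move=> B /IH[_ _]; apply; first exact: restr_coarse cF.
move=> Z /push_subfamily_bounded /FB FZ.
by apply: regular_FDC_embeds FZ; exact: restr_inverse_image.
Qed.

End Families.

Theorem theorem5p3 (R : realType) :
  [/\ forall X : metric_family R, finite_asdim X -> regular_FDC X,
      fibering_permanence (@regular_FDC R)
    & forall C : metric_family R -> Prop,
        (forall X : metric_family R, finite_asdim X -> C X) ->
        fibering_permanence C ->
        forall X : metric_family R, regular_FDC X -> C X].
Proof.
split; [exact: finite_asdim_regular_FDC|exact: regular_FDC_fibering|].
move=> C C_asdim C_fib X [alpha _ rk].
elim/regular_rank_induction: alpha X / rk => [_ X _ bX|alpha X Y F _ fY cF IH].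
  by apply: C_asdim; exact: bounded_finite_asdim.
by apply: (C_fib _ _ F) => // [|B /IH[]//]; exact: C_asdim.
Qed.
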